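(* Every true sequent $\Gamma$ (i.e. every sequent $\Gamma$ consisting of arithmetical sentences such that $\mathbb{N}\models\bigvee\Gamma$) has a $\Pi_0$-restricted $\infty$-proof.
   Context: **Formulas and sequents.** Arithmetical terms are built from individual variables $\mathit{Var}=\{x_0,x_1,\dots\}$ and the constant $0$ by the unary symbol $s$ and the binary symbols $+,\cdot$. Arithmetical formulas are given by $\varphi::=t=t\mid t\neq t\mid(\varphi\wedge\varphi)\mid(\varphi\vee\varphi)\mid\forall y\,\varphi\mid\exists y\,\varphi$. Negation $\overline{\varphi}$ is the syntactic operation swapping $=$ with $\neq$, $\wedge$ with $\vee$, $\forall$ with $\exists$ (so $\overline{\overline\varphi}=\varphi$). Put $\bot:=0\neq 0$, $\varphi\to\psi:=\overline\varphi\vee\psi$. $x\leq y$ abbreviates $\exists z\,(z+x=y)$. $\varphi[y\mapsto t]$ is the substitution of $t$ for all free occurrences of $y$ (no variable of $t$ may become bound). A sequent is a finite multiset of formulas, interpreted as $\bigvee\Gamma$ (with $\bigvee\emptyset:=\bot$); the comma denotes multiset union. $\mathit{FV}$ denotes the set of free variables. **Classes.** Bounded quantifiers: $\forall y\leq t\,\varphi:=\forall y(y\leq t\to\varphi)$, $\exists y\leq t\,\varphi:=\exists y(y\leq t\wedge\varphi)$, with $y$ not in $t$. $\Delta_0=\Sigma_0=\Pi_0$ is the set of formulas built from atomic formulas by logical connectives and bounded quantifiers only. **Calculus $\mathsf{SQ}$.** Initial sequents: $\Gamma,t_0=t_1,t_0\neq t_1$ and $\Gamma,s(t)\neq0$.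 Rules (premisses / conclusion): $(\wedge)$: $\Gamma,\varphi$ and $\Gamma,\psi$ / $\Gamma,\varphi\wedge\psi$; $(\vee)$: $\Gamma,\varphi,\psi$ / $\Gamma,\varphi\vee\psi$; $(\forall)$: $\Gamma,\varphi[y\mapsto z]$ / $\Gamma,\forall y\,\varphi$, where $z\notin\mathit{FV}(\Gamma,\forall y\,\varphi)$ ($z$ is the active variable); $(\exists)$: $\Gamma,\varphi[y\mapsto t],\exists y\,\varphi$ / $\Gamma,\exists y\,\varphi$; $(\mathsf{ref})$: $\Gamma,t\neq t$ / $\Gamma$; $(\mathsf{rep})$: $\Gamma,t_0\neq t_1,(u_0\neq u_1)[y\mapsto t_0],(u_0\neq u_1)[y\mapsto t_1]$ / $\Gamma,t_0\neq t_1,(u_0\neq u_1)[y\mapsto t_0]$; $(\mathsf{add}_0)$: $\Gamma,t+0\neq t$ / $\Gamma$; $(\mathsf{add}_s)$: $\Gamma,t+s(u)\neq s(t+u)$ / $\Gamma$; $(\mathsf{mult}_0)$: $\Gamma,t\cdot0\neq0$ / $\Gamma$; $(\mathsf{mult}_s)$: $\Gamma,t\cdot s(u)\neq t\cdot u+t$ / $\Gamma$; $(\mathsf{pred})$: $\Gamma,s(t_0)\neq s(t_1),t_0\neq t_1$ / $\Gamma,s(t_0)\neq s(t_1)$; $(\mathsf{case})$: left premiss $\Gamma[y\mapsto0]$ and right premiss $\Gamma[y\mapsto s(y)]$ / $\Gamma$, where $y\in\mathit{FV}(\Gamma)$ ($y$ is the active variable); $(\mathsf{weak})$: $\Gamma$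 / $\Gamma,\Delta$; $(\mathsf{cut})$: left premiss $\Gamma,\varphi$ and right premiss $\Gamma,\overline\varphi$ / $\Gamma$. **$\infty$-proofs.** An $\infty$-proof is a possibly infinite tree whose nodes are marked by sequents, constructed according to the rules of $\mathsf{SQ}$, with every leaf marked by an initial sequent, such that every infinite branch has a tail satisfying: (a) the tail does not pass through left premisses of $(\mathsf{case})$; (b) if the tail passes through the right premiss $\Gamma[z\mapsto s(z)]$ of $(\mathsf{case})$, then after that application the tail does not intersect applications of $(\forall)$ with active variable $z$; (c) for some variable $y$, the tail passes through the right premiss of $(\mathsf{case})$ with active variable $y$ infinitely many times. It is an $\infty$-proof of the sequent marking its root. (No regularity is required here.) An $\infty$-proof is $\Pi_0$-restricted if every infinite branch has a tail satisfying (a)–(c) and: (d) if the tail passes through the left (right) premiss of $(\wedge)$, then $\varphi$ ($\psi$) is in $\Pi_0$; (e) if the tail intersects an application of $(\forall)$, then $\varphi[y\mapsto z]\in\Pi_0$; (f) if the tail passes through the left (right) premiss of $(\mathsf{cut})$, then $\varphi$ ($\overline\varphi$) is in $\Pi_0$; (g) if the tail passes through the right premiss $\Gamma[z\mapsto s(z)]$ of $(\mathsf{case})$, then $z$ occurs freely only in $\Pi_0$-formulas of $\Gamma$. *)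

(* Defs.v *)
From HB Require Import structures.
From mathcomp Require Import all_boot.
From mathcomp Require Import finmap multiset.

Set Implicit Arguments.
Unset Strict Implicit.
Unset Printing Implicit Defensive.

Open Scope mset_scope.

                                                                                 
                                                                                 

Inductive term : Type :=
| Var of nat
| Zero
| Succ of term
| Add of term & term
| Mul of term & term.

Inductive formula : Type :=
| Eq of term & term
| Neq of term & term
| And of formula & formula
| Or of formula & formula
| All of nat & formula
| Ex of nat & formula.

                                                                                 
                                                                                 

Fixpoint term_enc (t : term) : GenTree.tree nat :=
  match t with
  | Var n => GenTree.Leaf n
  | Zero => GenTree.Node 0 [::]
  | Succ u => GenTree.Node 1 [:: term_enc u]
  | Add u v => GenTree.Node 2 [:: term_enc u; term_enc v]
  | Mul u v => GenTree.Node 3 [:: term_enc u; term_enc v]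
  end.

Fixpoint term_dec (g : GenTree.tree nat) : option term :=
  match g with
  | GenTree.Leaf n => Some (Var n)
  | GenTree.Node 0 [::] => Some Zero
  | GenTree.Node 1 [:: u] => omap Succ (term_dec u)
  | GenTree.Node 2 [:: u; v] =>
      if (term_dec u, term_dec v) is (Some u', Some v')
      then Some (Add u' v') else None
  | GenTree.Node 3 [:: u; v] =>
      if (term_dec u, term_dec v) is (Some u', Some v')
      then Some (Mul u' v') else None
  | _ => None
  end.

Lemma term_encK : pcancel term_enc term_dec.
Proof. by elim=> //= [t ->|t -> u ->|t -> u ->]. Qed.

HB.instance Definition _ := Countable.copy term (pcan_type term_encK).

Fixpoint formula_enc (A : formula) : GenTree.tree (term + nat) :=
  match A with
  | Eq t u =>
      GenTree.Node 0 [:: GenTree.Leaf (inl t); GenTree.Leaf (inl u)]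
  | Neq t u =>
      GenTree.Node 1 [:: GenTree.Leaf (inl t); GenTree.Leaf (inl u)]
  | And B C => GenTree.Node 2 [:: formula_enc B; formula_enc C]
  | Or B C => GenTree.Node 3 [:: formula_enc B; formula_enc C]
  | All y B => GenTree.Node 4 [:: GenTree.Leaf (inr y); formula_enc B]
  | Ex y B => GenTree.Node 5 [:: GenTree.Leaf (inr y); formula_enc B]
  end.

Fixpoint formula_dec (g : GenTree.tree (term + nat)) : option formula :=
  match g with
  | GenTree.Node 0 [:: GenTree.Leaf (inl t); GenTree.Leaf (inl u)] =>
      Some (Eq t u)
  | GenTree.Node 1 [:: GenTree.Leaf (inl t); GenTree.Leaf (inl u)] =>
      Some (Neq t u)
  | GenTree.Node 2 [:: B; C] =>
      if (formula_dec B, formula_dec C) is (Some B', Some C')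
      then Some (And B' C') else None
  | GenTree.Node 3 [:: B; C] =>
      if (formula_dec B, formula_dec C) is (Some B', Some C')
      then Some (Or B' C') else None
  | GenTree.Node 4 [:: GenTree.Leaf (inr y); B] => omap (All y) (formula_dec B)
  | GenTree.Node 5 [:: GenTree.Leaf (inr y); B] => omap (Ex y) (formula_dec B)
  | _ => None
  end.

Lemma formula_encK : pcancel formula_enc formula_dec.
Proof. by elim=> //= [A -> B ->|A -> B ->|y A ->|y A ->]. Qed.

HB.instance Definition _ := Countable.copy formula (pcan_type formula_encK).

Fixpoint neg (A : formula) : formula :=
  match A with
  | Eq t u => Neq t u
  | Neq t u => Eq t u
  | And B C => Or (neg B) (neg C)
  | Or B C => And (neg B) (neg C)
  | All y B => Ex y (neg B)
  | Ex y B => All y (neg B)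
  end.

Definition Bot : formula := Neq Zero Zero.
Definition Imp (A B : formula) : formula := Or (neg A) B.

Fixpoint tvars (t : term) : seq nat :=
  match t with
  | Var n => [:: n]
  | Zero => [::]
  | Succ u => tvars u
  | Add u v | Mul u v => tvars u ++ tvars v
  end.

Fixpoint fv (A : formula) : seq nat :=
  match A with
  | Eq t u | Neq t u => tvars t ++ tvars u
  | And B C | Or B C => fv B ++ fv C
  | All y B | Ex y B => [seq x <- fv B | x != y]
  end.

Definition sentence (A : formula) : Prop := fv A = [::].

Fixpoint tsubst (y : nat) (t u : term) : term :=
  match u with
  | Var n => if n == y then t else Var n
  | Zero => Zero
  | Succ v => Succ (tsubst y t v)
  | Add v w => Add (tsubst y t v) (tsubst y t w)
  | Mul v w => Mul (tsubst y t v) (tsubst y t w)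
  end.

                                                                                 
                                                                                 
                                                                                 
Fixpoint subst (y : nat) (t : term) (A : formula) : formula :=
  match A with
  | Eq u v => Eq (tsubst y t u) (tsubst y t v)
  | Neq u v => Neq (tsubst y t u) (tsubst y t v)
  | And B C => And (subst y t B) (subst y t C)
  | Or B C => Or (subst y t B) (subst y t C)
  | All x B => if x == y then All x B else All x (subst y t B)
  | Ex x B => if x == y then Ex x B else Ex x (subst y t B)
  end.

Fixpoint substitutable (y : nat) (t : term) (A : formula) : bool :=
  match A with
  | Eq _ _ | Neq _ _ => true
  | And B C | Or B C => substitutable y t B && substitutable y t C
  | All x B | Ex x B =>
      (x != y) && (y \in fv B) ==> (x \notin tvars t) && substitutable y t B
  end.

                                                                                 
                                                                                 
Definition Le (z : nat) (u t : term) : formula := Ex z (Eq (Add (Var z) u) t).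

                                                                                 
Inductive Delta0 : formula -> Prop :=
| Delta0_Eq t u : Delta0 (Eq t u)
| Delta0_Neq t u : Delta0 (Neq t u)
| Delta0_And A B : Delta0 A -> Delta0 B -> Delta0 (And A B)
| Delta0_Or A B : Delta0 A -> Delta0 B -> Delta0 (Or A B)
| Delta0_BAll y z t A :
    y \notin tvars t -> z != y -> z \notin tvars t -> Delta0 A ->
    Delta0 (All y (Imp (Le z (Var y) t) A))
| Delta0_BEx y z t A :
    y \notin tvars t -> z != y -> z \notin tvars t -> Delta0 A ->
    Delta0 (Ex y (And (Le z (Var y) t) A)).

Definition Pi0 : formula -> Prop := Delta0.

Definition sequent : Type := {mset formula}.

Definition fv_in (y : nat) (G : sequent) : Prop :=
  exists2 A, A \in G & y \in fv A.

Definition ssubst (y : nat) (t : term) (G : sequent) : sequent :=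
  seq_mset [seq subst y t A | A <- enum_mset G].

Definition bigor (G : sequent) : formula :=
  if enum_mset G is A :: s then foldl Or A s else Bot.

Fixpoint teval (e : nat -> nat) (t : term) : nat :=
  match t with
  | Var n => e n
  | Zero => 0
  | Succ u => (teval e u).+1
  | Add u v => teval e u + teval e v
  | Mul u v => teval e u * teval e v
  end.

Definition upd (e : nat -> nat) (y k : nat) : nat -> nat :=
  fun x => if x == y then k else e x.

Fixpoint sat (e : nat -> nat) (A : formula) : Prop :=
  match A with
  | Eq t u => teval e t = teval e u
  | Neq t u => teval e t <> teval e u
  | And B C => sat e B /\ sat e C
  | Or B C => sat e B \/ sat e C
  | All y B => forall k, sat (upd e y k) B
  | Ex y B => exists k, sat (upd e y k) B
  end.

Definition true_in_N (A : formula) : Prop := forall e, sat e A.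

Definition true_sequent (G : sequent) : Prop :=
  (forall A, A \in G -> sentence A) /\ true_in_N (bigor G).

                                                                                 
                                                                                 
                                                                                 
Inductive rule : Type :=
| RInitEq (G : sequent) (t0 t1 : term)
| RInitSucc (G : sequent) (t : term)
| RAnd (G : sequent) (A B : formula)
| ROr (G : sequent) (A B : formula)
| RAll (G : sequent) (y : nat) (A : formula) (z : nat)
| REx (G : sequent) (y : nat) (A : formula) (t : term)
| RRef (G : sequent) (t : term)
| RRep (G : sequent) (t0 t1 u0 u1 : term) (y : nat)
| RAdd0 (G : sequent) (t : term)
| RAddS (G : sequent) (t u : term)
| RMul0 (G : sequent) (t : term)
| RMulS (G : sequent) (t u : term)
| RPred (G : sequent) (t0 t1 : term)
| RCase (G : sequent) (y : nat)
| RWeak (G D : sequent)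
| RCut (G : sequent) (A : formula).

Definition conclusion (r : rule) : sequent :=
  match r with
  | RInitEq G t0 t1 => Eq t0 t1 +` (Neq t0 t1 +` G)
  | RInitSucc G t => Neq (Succ t) Zero +` G
  | RAnd G A B => And A B +` G
  | ROr G A B => Or A B +` G
  | RAll G y A _ => All y A +` G
  | REx G y A _ => Ex y A +` G
  | RRef G _ => G
  | RRep G t0 t1 u0 u1 y => Neq t0 t1 +` (subst y t0 (Neq u0 u1) +` G)
  | RAdd0 G _ => G
  | RAddS G _ _ => G
  | RMul0 G _ => G
  | RMulS G _ _ => G
  | RPred G t0 t1 => Neq (Succ t0) (Succ t1) +` G
  | RCase G _ => G
  | RWeak G D => G `+` D
  | RCut G _ => G
  end.

                                                                                 
Definition premisses (r : rule) : seq sequent :=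
  match r with
  | RInitEq _ _ _ | RInitSucc _ _ => [::]
  | RAnd G A B => [:: A +` G; B +` G]
  | ROr G A B => [:: A +` (B +` G)]
  | RAll G y A z => [:: subst y (Var z) A +` G]
  | REx G y A t => [:: subst y t A +` (Ex y A +` G)]
  | RRef G t => [:: Neq t t +` G]
  | RRep G t0 t1 u0 u1 y =>
      [:: Neq t0 t1 +`
            (subst y t0 (Neq u0 u1) +` (subst y t1 (Neq u0 u1) +` G))]
  | RAdd0 G t => [:: Neq (Add t Zero) t +` G]
  | RAddS G t u => [:: Neq (Add t (Succ u)) (Succ (Add t u)) +` G]
  | RMul0 G t => [:: Neq (Mul t Zero) Zero +` G]
  | RMulS G t u => [:: Neq (Mul t (Succ u)) (Add (Mul t u) t) +` G]
  | RPred G t0 t1 => [:: Neq (Succ t0) (Succ t1) +` (Neq t0 t1 +` G)]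
  | RCase G y => [:: ssubst y Zero G; ssubst y (Succ (Var y)) G]
  | RWeak G _ => [:: G]
  | RCut G A => [:: A +` G; neg A +` G]
  end.

                                                                                 
                                                                                 
Definition side_condition (r : rule) : Prop :=
  match r with
  | RAll G y A z => ~ fv_in z (All y A +` G) /\ substitutable y (Var z) A
  | REx _ y A t => substitutable y t A
  | RCase G y => fv_in y G
  | _ => True
  end.

                                                                                 
                                                                                 
                                                                                 
                                                                                 
Definition tree : Type := seq nat -> option rule.

Definition label (T : tree) (a : seq nat) : option sequent :=
  omap conclusion (T a).

                                                                                 
                                                                                 
Definition derivation (T : tree) (G : sequent) : Prop :=
  [/\ label T [::] = Some G,
      forall a i,
        label T (rcons a i) = obind (fun r => onth (premisses r) i) (T a)
    & forall a r, T a = Some r -> side_condition r].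

                                                                                 
                                                                                 
Definition infinite_branch (T : tree) (b : nat -> nat) (rho : nat -> rule)
    : Prop :=
  forall n, T (mkseq b n) = Some (rho n).

Definition left_premiss : nat := 0.
Definition right_premiss : nat := 1.

Definition tail_a (b : nat -> nat) (rho : nat -> rule) (N : nat) : Prop :=
  forall n G y, N <= n -> rho n = RCase G y -> b n <> left_premiss.

Definition tail_b (b : nat -> nat) (rho : nat -> rule) (N : nat) : Prop :=
  forall n G z, N <= n -> rho n = RCase G z -> b n = right_premiss ->
  forall m D y A, n < m -> rho m <> RAll D y A z.

Definition tail_c (b : nat -> nat) (rho : nat -> rule) (N : nat) : Prop :=
  exists y, forall k, exists n G,
    [/\ N <= n, k <= n, rho n = RCase G y & b n = right_premiss].

Definition tail_d (b : nat -> nat) (rho : nat -> rule) (N : nat) : Prop :=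
  forall n G A B, N <= n -> rho n = RAnd G A B ->
  (b n = left_premiss -> Pi0 A) /\ (b n = right_premiss -> Pi0 B).

Definition tail_e (b : nat -> nat) (rho : nat -> rule) (N : nat) : Prop :=
  forall n G y A z, N <= n -> rho n = RAll G y A z -> Pi0 (subst y (Var z) A).

Definition tail_f (b : nat -> nat) (rho : nat -> rule) (N : nat) : Prop :=
  forall n G A, N <= n -> rho n = RCut G A ->
  (b n = left_premiss -> Pi0 A) /\ (b n = right_premiss -> Pi0 (neg A)).

Definition tail_g (b : nat -> nat) (rho : nat -> rule) (N : nat) : Prop :=
  forall n G z, N <= n -> rho n = RCase G z -> b n = right_premiss ->
  forall A, A \in G -> z \in fv A -> Pi0 A.

Definition infty_proof (T : tree) (G : sequent) : Prop :=
  derivation T G /\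
  forall b rho, infinite_branch T b rho ->
    exists N, [/\ tail_a b rho N, tail_b b rho N & tail_c b rho N].

Definition Pi0_restricted (T : tree) : Prop :=
  forall b rho, infinite_branch T b rho ->
    exists N, [/\ tail_a b rho N, tail_b b rho N & tail_c b rho N] /\
              [/\ tail_d b rho N, tail_e b rho N, tail_f b rho N
                & tail_g b rho N].

(* Main.v *)
(** By induction on [A]: if [A] holds under the assignment [e], then [A] is
    derivable together with the disequations [numeral (e x) <> x] for the free
    variables [x] of [A].  Keeping values in such disequations instead of
    substituting numerals makes the induction structural, and the atomic case
    reduces to finite equational derivations.

    The omega-rule for [All y A] cannot be obtained by case distinction on [y]
    itself, since [A] need not be in [Pi0].  Instead a cut introduces a fresh
    variable [w] through [w <> y], and the infinite branch distinguishes cases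
    on [w]: its sequents are [s^n(w) <> y, A, ...], where [w] occurs only in an
    atomic formula.  The left premisses [numeral n <> y, A, ...] are covered by
    the induction hypothesis. *)

Require Import Defs.
From mathcomp Require Import all_boot.
From mathcomp Require Import finmap multiset.
From Stdlib Require Import Classical IndefiniteDescription.

Set Implicit Arguments.
Unset Strict Implicit.
Unset Printing Implicit Defensive.

(** * Substitution into terms, formulas and sequents *)

Lemma tsubst_fresh y t u : y \notin tvars u -> tsubst y t u = u.
Proof.
elim: u => //= [n|u IH|u IHu v IHv|u IHu v IHv].
- by rewrite inE eq_sym => /negPf->.
- by move=> /IH->.
- by rewrite mem_cat negb_or => /andP[/IHu-> /IHv->].
- by rewrite mem_cat negb_or => /andP[/IHu-> /IHv->].
Qed.

Lemma subst_fresh y t A : y \notin fv A -> subst y t A = A.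
Proof.
elim: A => /= [u v|u v|B IHB C IHC|B IHB C IHC|x B IH|x B IH];
  rewrite ?mem_cat ?negb_or ?mem_filter.
- by case/andP=> ? ?; rewrite !tsubst_fresh.
- by case/andP=> ? ?; rewrite !tsubst_fresh.
- by case/andP=> /IHB-> /IHC->.
- by case/andP=> /IHB-> /IHC->.
- by rewrite eq_sym; case: eqP => //= _ /IH->.
- by rewrite eq_sym; case: eqP => //= _ /IH->.
Qed.

Lemma tsubst_id y u : tsubst y (Var y) u = u.
Proof.
by elim: u => //= [n|u ->|u -> v ->|u -> v ->] //; case: eqP => [->|].
Qed.

Lemma subst_id y A : subst y (Var y) A = A.
Proof.
elim: A => //= [u v|u v|B -> C ->|B -> C ->|x B ->|x B ->] //;
  by rewrite ?tsubst_id // if_same.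
Qed.

Lemma substitutable_id y A : substitutable y (Var y) A.
Proof.
elim: A => //= [B -> C ->|B -> C ->|x B ->|x B ->] //;
  by rewrite andbT mem_seq1; case: (x == y); rewrite ?implybT.
Qed.

Lemma ssubst_add y t A G : ssubst y t (A +` G) = subst y t A +` ssubst y t G.
Proof.
rewrite /ssubst -mset_cons; apply/eq_seq_msetP.
rewrite -map_cons; apply: perm_map.
by rewrite -{1}[G]seq_mset_id -mset_cons perm_eq_seq_mset.
Qed.

Lemma ssubst_fresh y t G :
  (forall A, A \in G -> y \notin fv A) -> ssubst y t G = G.
Proof.
move=> fresh; rewrite /ssubst map_id_in ?seq_mset_id // => A GA.
exact/subst_fresh/fresh.
Qed.

(** * Infinite branches and the assembly of proof trees *)

Definition restricted_branch (b : nat -> nat) (rho : nat -> rule) : Prop :=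
  exists N, [/\ tail_a b rho N, tail_b b rho N & tail_c b rho N] /\
            [/\ tail_d b rho N, tail_e b rho N, tail_f b rho N
              & tail_g b rho N].

(** All conditions concern positions from some [N] on, so a bound [N] for the shifted branch becomes
    [k + N] for the original one. *)
Lemma restricted_branch_drop k b rho :
  restricted_branch (b \o addn k) (rho \o addn k) -> restricted_branch b rho.
Proof.
case=> N [[ha hb [y hc]] [hd he hf hg]].
have split_ge n : k + N <= n -> exists2 m, N <= m & n = k + m.
  move=> le_n; exists (n - k).
    by rewrite leq_subRL // (leq_trans _ le_n) ?leq_addr.
  by rewrite subnKC // (leq_trans _ le_n) ?leq_addr.
exists (k + N); split; split.
- by move=> _ G z /split_ge[n Nn ->]; apply: ha.
- move=> _ G z /split_ge[n Nn ->] rn bn m' D x A lt_m'.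
  have /split_ge[m Nm def_m'] : k + N <= m'.
    by apply: leq_trans (ltnW lt_m'); rewrite leq_add2l.
  move: lt_m'; rewrite def_m' ltn_add2l => lt_m.
  exact: (hb n G z Nn rn bn m D x A lt_m).
- exists y => j; have [n [G [Nn jn rn bn]]] := hc j.
  exists (k + n), G; split => //; first by rewrite leq_add2l.
  exact: leq_trans jn (leq_addl _ _).
- by move=> _ G A B /split_ge[n Nn ->]; apply: hd.
- by move=> _ G x A z /split_ge[n Nn ->]; apply: he.
- by move=> _ G A /split_ge[n Nn ->]; apply: hf.
- by move=> _ G z /split_ge[n Nn ->]; apply: hg.
Qed.

Lemma mkseq_behead (T : Type) (f : nat -> T) n :
  mkseq f n.+1 = f 0 :: mkseq (f \o S) n.
Proof. by rewrite /mkseq /= -[1]/(1 + 0) iotaDl -map_comp. Qed.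

Definition provable (G : sequent) : Prop :=
  exists T, derivation T G /\ Pi0_restricted T.

(** Addresses beyond the last premiss are left empty, because [derivation] demands the label [None]
    there. *)
Definition node (r : rule) (F : nat -> tree) : tree := fun a =>
  match a with
  | [::] => Some r
  | i :: a' => if i < size (premisses r) then F i a' else None
  end.

(** An infinite branch of the new tree enters one of the subtrees after its first step, and dropping
    that step leaves a branch already known to be restricted. *)
Lemma provable_rule r : side_condition r ->
  (forall i G, onth (premisses r) i = Some G -> provable G) ->
  provable (conclusion r).
Proof.
move=> side prem.
(* The choice ranges over all [i]; the empty tree is the default beyond the last premiss. *)
have /functional_choice[F hF] : forall i, exists T,
    forall G, onth (premisses r) i = Some G ->
    derivation T G /\ Pi0_restricted T.
  move=> i; have := prem i; case: (onth _ i) => [G|] h; last first.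
    by exists (fun=> None).
  have [T hT] := h G erefl; exists T => _ [<-]; exact: hT.
have F_prem i : i < size (premisses r) -> exists G,
    [/\ onth (premisses r) i = Some G, derivation (F i) G
      & Pi0_restricted (F i)].
  rewrite -onthTE; case E: (onth _ i) => [G|//] _.
  by exists G; case: (hF i G E).
exists (node r F); split; first split => //.
- case=> [|j a] i /=.
    rewrite {1}/label /=; case: ltnP => [/F_prem[G [-> [lab _ _] _]]//|].
    by rewrite -onthNE; case: onth.
  rewrite /label /=; case: ltnP => // /F_prem[G [_ [_ step _] _]].
  exact: step.
- case=> [|j a] r' /=; first by case=> <-.
  by case: ltnP => // /F_prem[G [_ [_ _ sd] _]]; apply: sd.
- move=> b rho br; apply: (@restricted_branch_drop 1).
  have br' n := br n.+1.
  have lt0 : b 0 < size (premisses r).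
    by move: (br' 0); rewrite mkseq_behead /=; case: ltnP.
  have [G [_ _ res]] := F_prem _ lt0; apply: res => n.
  by move: (br' n); rewrite mkseq_behead /= lt0.
Qed.

(** Recursion on the address yields an infinite tree: a run of 1s climbs the spine of right
    premisses, and the first 0 leads into the tree [L n] at the left premiss of rung [n]. *)
Fixpoint case_ladder (R : nat -> rule) (L : nat -> tree) (n : nat)
    (a : seq nat) : option rule :=
  match a with
  | [::] => Some (R n)
  | 0 :: a' => L n a'
  | 1 :: a' => case_ladder R L n.+1 a'
  | _ :: _ => None
  end.

(** A branch that takes a left premiss continues in a given restricted proof. The only other branch
    is the spine, where every rule is (case) on [w]: (a) and (c) hold by construction, (g) is the
    [Pi0] hypothesis, and the conditions about other rules are vacuous. *)
Lemma provable_case_ladder (S : nat -> sequent) w :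
  (forall n, fv_in w (S n)) ->
  (forall n A, A \in S n -> w \in fv A -> Pi0 A) ->
  (forall n, ssubst w (Succ (Var w)) (S n) = S n.+1) ->
  (forall n, provable (ssubst w Zero (S n))) ->
  provable (S 0).
Proof.
move=> wS piS succS /functional_choice[L hL].
pose R n := RCase (S n) w.
exists (case_ladder R L 0); split; first split => //.
- move=> a i; elim: a 0 => [|[|[|j]] a IH] n //=; rewrite /label /=.
  + case: i => [|[|i]] //=; first by case: (hL n) => -[].
    * by rewrite succS.
    * by case: i.
  + by have [[_ step _] _] := hL n; apply: step.
  + exact: IH.
- move=> a r; elim: a 0 => [|[|[|j]] a IH] n //=.
  + by case=> <-; apply: wS.
  + by have [[_ _ side] _] := hL n; apply: side.
  + exact: IH.
(* A branch that is not restricted cannot enter any [L n], so it must be the spine, which turns out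
   to be restricted after all. *)
- move=> b rho br; apply: NNPP => bad.
  have ladder n : (forall m, m < n -> b m = 1) /\
      infinite_branch (case_ladder R L n) (b \o addn n) (rho \o addn n).
    elim: n => [|n [b1 brn]]; first by split.
    have brn' m : case_ladder R L n (b n :: mkseq (b \o addn n.+1) m)
                  = Some (rho (n.+1 + m)).
      rewrite addSnnS -[RHS](brn m.+1) mkseq_behead /= addn0.
      by congr (case_ladder _ _ _ (_ :: _)); apply: eq_mkseq => i /=;
        rewrite addSnnS.
    have bn1 : b n = 1.
      case bn: (b n) brn' => [|[|i]] // brn'; last by have := brn' 0.
      case: bad; apply: (@restricted_branch_drop n.+1).
      by have [_ res] := hL n; apply: res.
    rewrite bn1 in brn'; split=> // m; rewrite ltnS leq_eqVlt.
    by case/predU1P=> [->|/b1].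
  exfalso; apply: bad.
  have b1 n : b n = 1 by have [h _] := ladder n.+1; apply: h.
  have rhoE n : rho n = R n.
    by have [_ h] := ladder n; move: (h 0); rewrite /= addn0 => -[].
  exists 0; split; split.
  + by move=> n G y _ _; rewrite b1.
  + by move=> n G z _ _ _ m D y A _; rewrite rhoE.
  + by exists w => k; exists k, (S k); split.
  + by move=> n G A B _; rewrite rhoE.
  + by move=> n G A B C _; rewrite rhoE.
  + by move=> n G A _; rewrite rhoE.
  + move=> n G z _; rewrite rhoE => -[<- <-] _ A; exact: piS.
Qed.

(** * Derived forms of the structural and logical rules *)

Lemma provable_init_eq G t u : Eq t u \in G -> Neq t u \in G -> provable G.
Proof.
move=> eqG neqG; pose H := (G `\ Eq t u) `\ Neq t u.
have -> : G = conclusion (RInitEq H t u).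
  by rewrite /= msetB1K ?msetB1K // in_msetB1 /= neqG.
by apply: provable_rule => // i K; case: i.
Qed.

Lemma provable_init_succ G t : Neq (Succ t) Zero \in G -> provable G.
Proof.
move=> /msetB1K <-.
by apply: (@provable_rule (RInitSucc _ _)) => // i K; case: i.
Qed.

Lemma provable_weak G H : G `<=` H -> provable G -> provable H.
Proof.
move=> /msetBDKC <- pG.
by apply: (@provable_rule (RWeak _ _)) => // -[|[]] //= K [<-].
Qed.

Lemma provable_cut G A :
  provable (A +` G) -> provable (neg A +` G) -> provable G.
Proof.
by move=> pA pN; apply: (@provable_rule (RCut G A)) => // -[|[|[]]] //= K [<-].
Qed.

Lemma provable_ex G y A t : substitutable y t A ->
  provable (subst y t A +` (Ex y A +` G)) -> provable (Ex y A +` G).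
Proof.
by move=> sub pA; apply: (@provable_rule (REx G y A t)) => // -[|[]] //= K [<-].
Qed.

(** The bound variable serves as its own active variable, so the premiss contains [A] unchanged. *)
Lemma provable_all_same G y A : ~ fv_in y G ->
  provable (A +` G) -> provable (All y A +` G).
Proof.
move=> fresh pA; apply: (@provable_rule (RAll G y A y)) => /=.
- split; last exact: substitutable_id.
  case=> B; rewrite in_mset1D => /predU1P[-> | GB yB].
    by rewrite /= mem_filter eqxx.
  by apply: fresh; exists B.
- by case=> [|[]] //= K [<-]; rewrite subst_id.
Qed.

Lemma msubset_add A (G : sequent) : G `<=` A +` G.
Proof. by apply/msubsetP => B; rewrite mset1DE leq_addl. Qed.

(** * Equational reasoning *)

(** Sequents being one-sided, a disequation in [G] acts as an equational hypothesis. *)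
Definition entails_eq (G : sequent) (t u : term) : Prop :=
  provable (Eq t u +` G).

Lemma entails_eq_weak G H t u :
  G `<=` H -> entails_eq G t u -> entails_eq H t u.
Proof. by move=> GH; apply/provable_weak/msetDS. Qed.

Lemma entails_eq_use G t u :
  entails_eq G t u -> provable (Neq t u +` G) -> provable G.
Proof. exact: provable_cut. Qed.

(** The axiom-like rules discharge a disequation. When [Eq t u] already stands in the sequent, the
    premiss of such a rule is initial; [h] supplies the rule. *)
Lemma entails_eq_intro G t u :
  (forall H, G `<=` H -> provable (Neq t u +` H) -> provable H) ->
  entails_eq G t u.
Proof.
move=> h; apply: h; first exact: msubset_add.
by apply: (@provable_init_eq _ t u); rewrite !in_mset1D eqxx ?orbT.
Qed.

Lemma entails_eq_hyp G t u : Neq t u \in G -> entails_eq G t u.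
Proof.
by move=> h; apply: (@provable_init_eq _ t u);
  rewrite in_mset1D ?eqxx ?h ?orbT.
Qed.

Lemma entails_eq_refl G t : entails_eq G t t.
Proof.
apply: entails_eq_intro => H _ pH.
by apply: (@provable_rule (RRef H t)) => // -[|[]] //= K [<-].
Qed.

(** Two cuts bring both equations into the sequent as hypotheses, and (rep) then applies. *)
Lemma entails_eq_rep G t0 t1 u0 u1 y : entails_eq G t0 t1 ->
  entails_eq G (tsubst y t0 u0) (tsubst y t0 u1) ->
  entails_eq G (tsubst y t1 u0) (tsubst y t1 u1).
Proof.
move=> et eu; apply: entails_eq_intro => H GH pH.
apply: (@entails_eq_use _ (tsubst y t0 u0) (tsubst y t0 u1)).
  exact: entails_eq_weak eu.
apply: (@entails_eq_use _ t0 t1).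
  exact: entails_eq_weak (msubset_trans GH (msubset_add _ _)) et.
apply: (@provable_rule (RRep H t0 t1 u0 u1 y)) => // -[|[]] //= K [<-].
apply: provable_weak pH.
exact: msubset_trans (msubset_add _ _) (msubset_add _ _).
Qed.

Definition fresh_var (s : seq nat) : nat := (foldr maxn 0 s).+1.

Lemma fresh_varP s : fresh_var s \notin s.
Proof.
have le_max x : x \in s -> x <= foldr maxn 0 s.
  elim: s => //= y s IH; rewrite inE leq_max.
  by case/predU1P=> [->|/IH->]; rewrite ?leqnn ?orbT.
by apply/negP => /le_max; rewrite ltnn.
Qed.

(** The left side of [t = t] is rewritten to [u]; the fresh [y] marks the occurrence to be
    replaced. *)
Lemma entails_eq_sym G t u : entails_eq G t u -> entails_eq G u t.
Proof.
move=> e; pose y := fresh_var (tvars t).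
have h v : tsubst y v t = t by rewrite tsubst_fresh ?fresh_varP.
have := @entails_eq_rep G t u (Var y) t y e; rewrite !h /= eqxx; apply.
exact: entails_eq_refl.
Qed.

Lemma entails_eq_trans G t u v :
  entails_eq G t u -> entails_eq G u v -> entails_eq G t v.
Proof.
move=> etu euv; pose y := fresh_var (tvars t).
have h w : tsubst y w t = t by rewrite tsubst_fresh ?fresh_varP.
by have := @entails_eq_rep G u v t (Var y) y euv; rewrite !h /= eqxx; apply.
Qed.

Lemma entails_eq_succ G t u :
  entails_eq G t u -> entails_eq G (Succ t) (Succ u).
Proof.
move=> e; pose y := fresh_var (tvars t).
have h v : tsubst y v t = t by rewrite tsubst_fresh ?fresh_varP.
have := @entails_eq_rep G t u (Succ t) (Succ (Var y)) y e.
by rewrite /= !h eqxx; apply; apply: entails_eq_refl.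
Qed.

(** One argument is rewritten at a time; abstracting over [f] treats addition and multiplication
    together. *)
Lemma entails_eq_binary (f : term -> term -> term) G t t' u u' :
  (forall y v w w', tsubst y v (f w w') = f (tsubst y v w) (tsubst y v w')) ->
  entails_eq G t t' -> entails_eq G u u' -> entails_eq G (f t u) (f t' u').
Proof.
move=> fE et eu; pose y := fresh_var (tvars t ++ tvars t' ++ tvars u).
have := fresh_varP (tvars t ++ tvars t' ++ tvars u).
rewrite -/y !mem_cat !negb_or => /and3P[yt yt' yu].
have ht v : tsubst y v t = t by rewrite tsubst_fresh.
have ht' v : tsubst y v t' = t' by rewrite tsubst_fresh.
have hu v : tsubst y v u = u by rewrite tsubst_fresh.
have hy v : tsubst y v (Var y) = v by rewrite /= eqxx.
apply: (@entails_eq_trans _ _ (f t' u)).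
  have := @entails_eq_rep G t t' (f t u) (f (Var y) u) y et.
  rewrite !fE !hy !ht !hu.
  by apply; apply: entails_eq_refl.
have := @entails_eq_rep G u u' (f t' u) (f t' (Var y)) y eu.
rewrite !fE !hy !ht' !hu.
by apply; apply: entails_eq_refl.
Qed.

Fixpoint numeral (n : nat) : term :=
  if n is m.+1 then Succ (numeral m) else Zero.

Lemma entails_eq_add_numeral G m n :
  entails_eq G (Add (numeral m) (numeral n)) (numeral (m + n)).
Proof.
elim: n => [|n IH] /=.
  rewrite addn0; apply: entails_eq_intro => H _ pH.
  by apply: (@provable_rule (RAdd0 H (numeral m))) => // -[|[]] //= K [<-].
rewrite addnS /=; apply: entails_eq_trans (entails_eq_succ IH).
apply: entails_eq_intro => H _ pH.
apply: (@provable_rule (RAddS H (numeral m) (numeral n))) => //.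
by case=> [|[]] //= K [<-].
Qed.

Lemma entails_eq_mul_numeral G m n :
  entails_eq G (Mul (numeral m) (numeral n)) (numeral (m * n)).
Proof.
elim: n => [|n IH] /=.
  rewrite muln0; apply: entails_eq_intro => H _ pH.
  by apply: (@provable_rule (RMul0 H (numeral m))) => // -[|[]] //= K [<-].
rewrite mulnSr; apply: entails_eq_trans (entails_eq_add_numeral _ _ _).
have := @entails_eq_binary Add _ _ _ _ _ (fun _ _ _ _ => erefl) IH
          (entails_eq_refl G (numeral m)).
apply: entails_eq_trans; apply: entails_eq_intro => H _ pH.
apply: (@provable_rule (RMulS H (numeral m) (numeral n))) => //.
by case=> [|[]] //= K [<-].
Qed.

(** The orientation is the one produced by the left premisses in [provable_omega], where
    [s^n(w) <> y] turns into [numeral n <> y]. *)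
Definition records (e : nat -> nat) (s : seq nat) (G : sequent) : Prop :=
  forall x, x \in s -> Neq (numeral (e x)) (Var x) \in G.

Lemma recordsS e s s' (G H : sequent) : {subset s' <= s} -> {subset G <= H} ->
  records e s G -> records e s' H.
Proof. by move=> ss GH rec x /ss/rec/GH. Qed.

Lemma subset_catl (T : eqType) (s s' : seq T) : {subset s <= s ++ s'}.
Proof. by move=> x; rewrite mem_cat => ->. Qed.

Lemma subset_catr (T : eqType) (s s' : seq T) : {subset s' <= s ++ s'}.
Proof. by move=> x; rewrite mem_cat orbC => ->. Qed.

Lemma entails_eq_teval e G t :
  records e (tvars t) G -> entails_eq G t (numeral (teval e t)).
Proof.
have sub s s' : {subset s' <= s} -> records e s G -> records e s' G.
  by move=> h; apply: recordsS.
elim: t => [x||t IH|t IHt u IHu|t IHt u IHu] /= rec.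
- by apply/entails_eq_sym/entails_eq_hyp/rec; rewrite inE.
- exact: entails_eq_refl.
- exact/entails_eq_succ/IH.
- apply: entails_eq_trans (entails_eq_add_numeral _ _ _).
  by apply: entails_eq_binary => //; [apply: IHt|apply: IHu];
    apply: sub rec; [apply: subset_catl|apply: subset_catr].
- apply: entails_eq_trans (entails_eq_mul_numeral _ _ _).
  by apply: entails_eq_binary => //; [apply: IHt|apply: IHu];
    apply: sub rec; [apply: subset_catl|apply: subset_catr].
Qed.

(** Successors are stripped by (pred) until one side is zero, where [s(t) <> 0] is initial. [G]
    varies because each step adds a disequation. *)
Lemma provable_numeral_neq G m n :
  m <> n -> entails_eq G (numeral m) (numeral n) -> provable G.
Proof.
elim: m n G => [|m IH] [|n] G //= mn e.
- apply: entails_eq_use (entails_eq_sym e) _.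
  by apply: (@provable_init_succ _ (numeral n)); rewrite in_mset1D eqxx.
- apply: entails_eq_use e _.
  by apply: (@provable_init_succ _ (numeral m)); rewrite in_mset1D eqxx.
- apply: entails_eq_use e _.
  apply: (@provable_rule (RPred G (numeral m) (numeral n))) => //.
  case=> [|[]] //= K [<-].
  apply: (IH n); first by move=> mn'; apply: mn; rewrite mn'.
  by apply: entails_eq_hyp; rewrite !in_mset1D eqxx orbT.
Qed.

(** * Truth implies provability *)

(** Duplicates are removed because multiset inclusion counts multiplicities, whereas [records] only
    provides membership. *)
Definition record_sequent (e : nat -> nat) (s : seq nat) : sequent :=
  seq_mset (undup [seq Neq (numeral (e x)) (Var x) | x <- s]).

Lemma mem_record_sequent e s A :
  (A \in record_sequent e s) =
  (A \in [seq Neq (numeral (e x)) (Var x) | x <- s]).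
Proof. by rewrite (perm_mem (perm_eq_seq_mset _)) mem_undup. Qed.

Lemma records_record_sequent e s : records e s (record_sequent e s).
Proof. by move=> x sx; rewrite mem_record_sequent; apply/mapP; exists x. Qed.

Lemma record_sequent_subset e s G : records e s G -> record_sequent e s `<=` G.
Proof.
move=> rec; apply/msubsetP => A.
rewrite mset_seqE count_uniq_mem ?undup_uniq // mem_undup.
by case: mapP => // -[x sx ->]; rewrite mset_gt0 rec.
Qed.

Lemma tvars_numeral n : tvars (numeral n) = [::].
Proof. by elim: n. Qed.

Lemma fv_in_record_sequent x e s : fv_in x (record_sequent e s) -> x \in s.
Proof.
case=> A; rewrite mem_record_sequent => /mapP[y sy ->] /=.
by rewrite tvars_numeral inE => /eqP->.
Qed.

Lemma tsubst_iter_succ n y t :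
  tsubst y t (iter n Succ (Var y)) = iter n Succ t.
Proof. by elim: n => /= [|n ->]; rewrite ?eqxx. Qed.

Lemma iter_succ_zero n : iter n Succ Zero = numeral n.
Proof. by elim: n => //= n ->. Qed.

Lemma tvars_iter_succ n t : tvars (iter n Succ t) = tvars t.
Proof. by elim: n. Qed.

Lemma records_upd e y n A (G : sequent) :
  records e [seq x <- fv A | x != y] G -> Neq (numeral n) (Var y) \in G ->
  records (upd e y n) (fv A) G.
Proof.
move=> rec yG x xA; rewrite /upd; case: eqP => [->//|/eqP xy].
by apply: rec; rewrite mem_filter xy.
Qed.

(** The (∀) steps and the cut are passed once, before the tail on the ladder begins, so conditions
    (e) and (f) put no constraint on [A] or on the cut formula. *)
Lemma provable_omega G A y : ~ fv_in y G ->
  (forall n, provable (Neq (numeral n) (Var y) +` (A +` G))) ->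
  provable (All y A +` G).
Proof.
move=> yG pA; apply: provable_all_same => //.
pose w := fresh_var (y :: flatten [seq fv B | B <- enum_mset (A +` G)]).
have := fresh_varP (y :: flatten [seq fv B | B <- enum_mset (A +` G)]).
rewrite -/w inE negb_or => /andP[wy wAG].
have fresh B : B \in A +` G -> w \notin fv B.
  by move=> GB; apply: contra wAG => wB; apply/flatten_mapP; exists B.
(* The negated cut formula, [exists w, w = y], has the witness [y]; the cut formula itself leads to
   the ladder, starting at [w <> y]. *)
apply: (@provable_cut _ (All w (Neq (Var w) (Var y)))) => /=; last first.
  apply: (@provable_ex _ _ _ (Var y)) => //=.
  by rewrite eqxx eq_sym (negPf wy); apply: entails_eq_refl.
apply: provable_all_same => [[B /fresh/negP]//|].
(* With [w] innermost, substituting [s(w)] gives the next rung and substituting [0] leaves the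
   numeral [n]. *)
pose rung n := Neq (iter n Succ (Var w)) (Var y) +` (A +` G).
have rung_subst t n :
    ssubst w t (rung n) = Neq (iter n Succ t) (Var y) +` (A +` G).
  rewrite /rung ssubst_add (ssubst_fresh _ fresh) [subst _ _ _]/=.
  by rewrite tsubst_iter_succ [y == w]eq_sym (negPf wy).
apply: (@provable_case_ladder rung w) => [n|n B|n|n].
- exists (Neq (iter n Succ (Var w)) (Var y)); first exact: mset1D1.
  by rewrite /= tvars_iter_succ mem_head.
- rewrite in_mset1D => /predU1P[-> _|/fresh/negPf->//]; exact: Delta0_Neq.
- by rewrite rung_subst -iterSr.
- by rewrite rung_subst iter_succ_zero.
Qed.

(** [e] and [G] are general in the induction because quantifiers change the value of [y] and replace
    the context. *)
Lemma provable_sat A e G : sat e A -> records e (fv A) G -> provable (A +` G).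
Proof.
have [catl catr] := (@subset_catl nat, @subset_catr nat).
have mem_add B (H : sequent) : {subset H <= B +` H}.
  exact/msubset_subset/msubset_add.
elim: A e G => [t u|t u|A IHA B IHB|A IHA B IHB|y A IH|y A IH] e G /=.
- move=> eq_tu rec; apply: (@entails_eq_trans _ _ (numeral (teval e t))).
    by apply: entails_eq_teval; apply: recordsS rec.
  by rewrite eq_tu; apply/entails_eq_sym/entails_eq_teval; apply: recordsS rec.
(* Here [t <> u] in the sequent serves as the hypothesis [t = u], which equates two distinct
   numerals. *)
- move=> neq_tu rec; apply: provable_numeral_neq neq_tu _.
  apply: (@entails_eq_trans _ _ t).
    apply/entails_eq_sym/entails_eq_teval.
    by apply: recordsS rec; [apply: catl|apply: mem_add].
  apply: (@entails_eq_trans _ _ u).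
    by apply: entails_eq_hyp; apply: mset1D1.
  apply: entails_eq_teval.
  by apply: recordsS rec; [apply: catr|apply: mem_add].
- move=> [satA satB] rec; apply: (@provable_rule (RAnd G A B)) => //.
  case=> [|[|[]]] //= K [<-].
    by apply: IHA satA _; apply: recordsS rec.
  by apply: IHB satB _; apply: recordsS rec.
- move=> satAB rec; apply: (@provable_rule (ROr G A B)) => //.
  case=> [|[]] //= K [<-]; case: satAB => [satA|satB].
    by apply: IHA satA _; apply: recordsS rec; [apply: catl|apply: mem_add].
  rewrite msetDCA.
  by apply: IHB satB _; apply: recordsS rec; [apply: catr|apply: mem_add].
- move=> satA rec; set s := [seq x <- fv A | x != y] in rec.
  (* [y] may be free in [G]; the context is cut down to the records of the other variables of [A],
     in which [y] does not occur. *)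
  apply: provable_weak (msetDS _ (record_sequent_subset rec)) _.
  apply: provable_omega => [/fv_in_record_sequent|n].
    by rewrite mem_filter eqxx.
  rewrite msetDCA; apply: IH (satA n) _; apply: records_upd;
    last exact: mset1D1.
  by have := @records_record_sequent e s; apply: recordsS.
- move=> [k satA] rec; set s := [seq x <- fv A | x != y] in rec.
  apply: provable_weak (msetDS _ (record_sequent_subset rec)) _.
  set E := record_sequent e s.
  (* This cut creates the record of the witness [k]: one premiss is closed by instantiating with
     [numeral k], the other yields [numeral k <> y] for the active variable [y]. *)
  apply: (@provable_cut _ (All y (Neq (numeral k) (Var y)))) => /=; last first.
    apply: (@provable_ex _ _ _ (numeral k)) => //=.
    rewrite eqxx tsubst_fresh ?tvars_numeral //; exact: entails_eq_refl.
  apply: provable_all_same => [[B]|].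
    rewrite in_mset1D => /predU1P[->|EB yB]; first by rewrite mem_filter eqxx.
    have /fv_in_record_sequent : fv_in y E by exists B.
    by rewrite mem_filter eqxx.
  (* Instantiating with [y] itself keeps [A] unchanged, as the induction hypothesis requires; the
     value [k] is held by the record. *)
  rewrite msetDCA; apply: (@provable_ex _ _ _ (Var y)).
    exact: substitutable_id.
  rewrite subst_id; apply: IH satA _; apply: records_upd.
    have := @records_record_sequent e s; apply: recordsS => // B EB.
    by rewrite !in_mset1D EB !orbT.
  by rewrite !in_mset1D eqxx orbT.
Qed.

Lemma sat_foldl_Or e A s : sat e (foldl Or A s) ->
  exists2 B, B \in A :: s & sat e B.
Proof.
elim: s A => [|C s IH] A /= h; first by exists A; rewrite ?mem_head.
have [B] := IH _ h; rewrite inE => /predU1P[-> /= [] satB|sB satB].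
- by exists A; rewrite ?mem_head.
- by exists C; rewrite // !inE eqxx orbT.
- by exists B; rewrite // !inE sB !orbT.
Qed.

Theorem lemma3p3 (G : sequent) (hG : true_sequent G) :
  exists T : tree, infty_proof T G /\ Pi0_restricted T.
Proof.
case: hG => sen /(_ (fun=> 0)) satG.
have [A GA satA] : exists2 A, A \in G & sat (fun=> 0) A.
  move: satG; rewrite /bigor.
  have memE B : B \in enum_mset G -> B \in G by [].
  (* The empty sequent is excluded because [Bot] is false. *)
  case: (enum_mset G) memE => [_ //|B s memE /sat_foldl_Or[A sA satA]].
  by exists A => //; apply: memE.
(* A sentence has no variables to record, so the rest of [G] can serve as context. *)
have [T [der res]] : provable G.
  rewrite -(msetB1K GA); apply: provable_sat satA _.
  by rewrite (sen A GA) => x.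
(* Being [Pi0]-restricted includes (a) to (c), so [T] is an infinitary proof as well. *)
exists T; split=> //; split=> // b rho /res[N [abc _]].
by exists N.
Qed.
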